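(* Let $\mathcal{G}_d^+=(\mathcal{N}_d^+,\mathcal{A}_d^+)$ be the directed graph for driver $d\in\mathcal{O}^+=\{1,\dots,n\}$, with travel times $\tau_{(i,j)}\ge 0$ satisfying the triangle inequality, service durations $s_i\ge 0$, time windows $[a_i,b_i]$, demands $\kappa_i\ge 0$, ride-duration limits $L_i$, vehicle capacity $K$, and real edge costs $c_{(i,j)}$ (possibly negative). If $$L_i<2\tau_{(i,n+i)}+s_i\qquad\text{for each } i\in\mathcal{O}^+,$$ then no non-elementary path is generated by the resource-constrained shortest path algorithm (RCSPA) on $\mathcal{G}_d^+$; that is, every path from $d$ to $n+d$ generated by the RCSPA visits each node of $\mathcal{N}_d^+$ at most once.
   Context: **Graph.** Let $n\ge 1$ be the number of riders, $\mathcal{O}^+=\{1,\dots,n\}$ the set of pickup (origin) nodes and $\mathcal{D}^+=\{n+1,\dots,2n\}$ the set of drop-off (destination) nodes. Node $i\in\mathcal{O}^+$ is the origin of rider $i$ and $n+i$ is her destination. Fix a driver $d\in\mathcal{O}^+$. The graph $\mathcal{G}_d^+$ has node set $\mathcal{N}_d^+=\mathcal{O}^+\cup\mathcal{D}^+$ and a set $\mathcal{A}_d^+$ of directed edges between distinct nodes (the complete set of edges, from which some edges may have been removed in preprocessing). Each node $i\in\mathcal{N}_d^+$ has a time window $[a_i,b_i]$ and a service duration $s_i\ge 0$. Each $i\in\mathcal{O}^+$ has a ride-duration limit $L_i$ and a demand $\kappa_i\ge 0$. Each edge has a cost $c_{(i,j)}\in\mathbb{R}$. Travel times $\tau_{(i,j)}\ge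 0$ are defined for all pairs of nodes and satisfy the triangle inequality. $K$ is the vehicle capacity. **Labels.** A path (walk in $\mathcal{G}_d^+$, nodes may a priori be repeated) $\mathcal{P}$ from $d$ to a node $l$ carries a label $(c,T,\mathcal{C},\mathcal{R},\mathcal{W})$. Here $c$ is the total edge cost and $T$ is the service start time at $l$. $\mathcal{C}\subseteq\mathcal{O}^+$ is the set of riders on board after visiting $l$, and $\mathcal{R}\subseteq\mathcal{O}^+$ is the set of all riders picked up so far. $\mathcal{W}=\{w(m):m\in\mathcal{R}\}$ collects, for each rider $m\in\mathcal{R}$, the accumulated trip duration excluding wait times, i.e. the sum of $s_i+\tau_{(i,j)}$ over all edges $(i,j)$ of $\mathcal{P}$ (counted with multiplicity) traversed while $m$ is on board. **Initialization.** The trivial path at $d$ has label $c=0$, $T=a_d$, $\mathcal{C}=\{d\}$, $\mathcal{R}=\{d\}$, $w(d)=0$. **Extension.** A path ending at $l$ with label $(c,T,\mathcal{C},\mathcal{R},\mathcal{W})$ is extended along an edge $(l,j)\in\mathcal{A}_d^+$ to a path with label $(c',T',\mathcal{C}',\mathcal{R}',\mathcal{W}')$ given by: - $c'=c+c_{(l,j)}$. - $T'=\max\{a_j,\,T+s_l+\tau_{(l,j)}\}$ if $j\in\mathcal{O}^+$, and $T'=T+s_l+\tau_{(l,j)}$ otherwise. - $\mathcal{C}'=\mathcal{C}\cup\{j\}$ if $j\in\mathcal{O}^+$, and $\mathcal{C}'=\mathcal{C}\setminus\{j-n\}$ otherwise. - $\mathcal{R}'=\mathcal{R}\cup\{j\}$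 if $j\in\mathcal{O}^+$, and $\mathcal{R}'=\mathcal{R}$ otherwise. - $w'(j)=0$ if $j\in\mathcal{O}^+$ and $j\notin\mathcal{R}$; $w'(i)=w(i)+s_l+\tau_{(l,j)}$ for all $i\in\mathcal{C}$; and $w'(i)=w(i)$ for all $i\in\mathcal{R}\setminus\mathcal{C}$. In particular, $w(i)$ is not reset if rider $i$ is picked up again. The extension is performed only if all of the following hold: - $T'\le b_j$. - $j\notin\mathcal{C}$ if $j\in\mathcal{O}^+$. - $j-n\in\mathcal{C}$ if $j\in\mathcal{D}^+$. - $\sum_{i\in\mathcal{C}'}\kappa_i\le K$. - $w'(i)-s_i\le L_i$ for all $i\in\mathcal{C}$. **Generated paths.** A path from $d$ to $n+d$ is *generated by the RCSPA* if it is obtained from the trivial path at $d$ by a finite sequence of such extensions and its final label has $\mathcal{C}=\emptyset$. (The algorithm outputs a minimum-cost path among such paths; any additional pruning of labels it performs only removes paths.) A path is *elementary* if it visits each node at most once, and *non-elementary* otherwise. *)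

(* Defs.v *)
From HB Require Import structures.
From mathcomp Require Import all_boot all_order all_algebra.

Set Implicit Arguments.
Unset Strict Implicit.
Unset Printing Implicit Defensive.

Import Order.TTheory GRing.Theory Num.Theory.

Local Open Scope ring_scope.

(* Riders are indexed from 0 by 'I_n.  The node set is the disjoint union of
   the pickup and drop-off nodes: [inl i] is the origin of rider i (node i)
   and [inr i] is her destination (node n + i). *)
Notation node n := ('I_n + 'I_n)%type.

Record instance (R : realFieldType) (n : nat) := Instance {
  edge : rel (node n);
  edge_cost : node n -> node n -> R;  (* only relevant on edges *)
  travel : node n -> node n -> R;
  service : node n -> R;
  tw_start : node n -> R;
  tw_end : node n -> R;
  ride_limit : 'I_n -> R;
  demand : 'I_n -> R;
  capacity : R
}.

(* The label (c, T, C, R, W).  The family W is indexed by the riders in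
   [picked_up]; the values of [trip] at other riders are meaningless. *)
Record label (R : realFieldType) (n : nat) := Label {
  cost : R;
  start_time : R;
  on_board : {set 'I_n};
  picked_up : {set 'I_n};
  trip : 'I_n -> R
}.

Definition init_label (R : realFieldType) (n : nat) (I : instance R n)
    (d : 'I_n) : label R n :=
  Label 0 (tw_start I (inl d)) [set d] [set d] (fun=> 0).

(* The label obtained from the label [x] at [l] by traversing (l, j). *)
Definition extend_label (R : realFieldType) (n : nat) (I : instance R n)
    (l j : node n) (x : label R n) : label R n :=
  let dt := service I l + travel I l j in
  {| cost := cost x + edge_cost I l j;
     start_time :=
       match j with
       | inl _ => Num.max (tw_start I j) (start_time x + dt)
       | inr _ => start_time x + dt
       end;
     on_board :=
       match j with
       | inl k => k |: on_board x
       | inr k => on_board x :\ k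
       end;
     picked_up :=
       match j with
       | inl k => k |: picked_up x
       | inr _ => picked_up x
       end;
     trip := fun i =>
       if (j == inl i) && (i \notin picked_up x) then 0
       else if i \in on_board x then trip x i + dt
       else trip x i |}.

Definition feasible (R : realFieldType) (n : nat) (I : instance R n)
    (l j : node n) (x : label R n) : bool :=
  let x' := extend_label I l j x in
  [&& start_time x' <= tw_end I j,
      match j with
      | inl k => k \notin on_board x
      | inr k => k \in on_board x
      end,
      \sum_(i in on_board x') demand I i <= capacity I
    & [forall i in on_board x,
         trip x' i - service I (inl i) <= ride_limit I i]].

(* [extension_path I d P x]: the walk with successive nodes [P] is obtained
   from the trivial path at the origin of [d] by feasible extensions, and [x]
   is its label. *)
Inductive extension_path (R : realFieldType) (n : nat) (I : instance R n)
    (d : 'I_n) : seq (node n) -> label R n -> Prop :=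
| TrivialPath : extension_path I d [:: inl d] (init_label I d)
| ExtendedPath P l j x :
    extension_path I d (rcons P l) x -> edge I l j -> feasible I l j x ->
    extension_path I d (rcons (rcons P l) j) (extend_label I l j x).

Definition generated (R : realFieldType) (n : nat) (I : instance R n)
    (d : 'I_n) (P : seq (node n)) : Prop :=
  last (inl d) P = inr d /\
  exists2 x : label R n, extension_path I d P x & on_board x = set0.

Definition elementary (n : nat) (P : seq (node n)) : bool := uniq P.

(* Main.v *)
(* Every completed trip of rider i adds at least s_i + tau(i, n+i) to w(i), by
   the triangle inequality, and w(i) is never reset. At a second drop-off of i
   this gives w(i) - s_i >= 2 tau(i, n+i) + s_i > L_i, so the extension is
   infeasible. Pickups and drop-offs of i alternate and nobody is left on
   board at the end, so both nodes of i are visited at most once. *)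
Require Import Defs.
From HB Require Import structures.
From mathcomp Require Import all_boot all_order all_algebra.
From mathcomp Require Import lra.

Set Implicit Arguments.
Unset Strict Implicit.
Unset Printing Implicit Defensive.

Import Order.TTheory GRing.Theory Num.Theory.

Local Open Scope ring_scope.

Lemma inl_eqE (A B : eqType) (a b : A) :
  (inl a == inl b :> A + B) = (a == b).
Proof. by []. Qed.

Lemma inr_eqE (A B : eqType) (a b : B) :
  (inr a == inr b :> A + B) = (a == b).
Proof. by []. Qed.

Section Walks.

Context (R : realFieldType) (n : nat) (I : instance R n) (d : 'I_n).
Implicit Types (i : 'I_n) (P : seq (node n)) (x : label R n).

Lemma picked_upE i P x :
  extension_path I d P x -> (i \in picked_up x) = (inl i \in P).
Proof.
elim=> [|{}P l [k|k] {}x _ IH _ _]; first by rewrite /= in_set1 mem_seq1.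
  by rewrite /= in_setU1 mem_rcons in_cons inl_eqE IH.
by rewrite mem_rcons in_cons -IH.
Qed.

Lemma count_pickup i P x :
  extension_path I d P x ->
  count_mem (inl i) P = ((i \in on_board x) + count_mem (inr i) P)%N.
Proof.
elim=> [|{}P l j {}x _ IH _ /and4P[_ jx _ _]].
  by rewrite /= in_set1 inl_eqE eq_sym !addn0.
rewrite -cats1 !count_cat {}IH /=; case: j jx => k kx.
  rewrite inl_eqE in_setU1 [i == k]eq_sym.
  by case: (eqVneq i k) kx => [-> /negbTE->|_ _] /=; rewrite ?addn0 // addnC.
rewrite inr_eqE in_setD1 [i == k]eq_sym.
by case: (eqVneq i k) kx => [-> ->|_ _] /=; rewrite ?addn0 // addnC.
Qed.

Hypothesis travel_triangle : forall u v w : node n,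
  travel I u w <= travel I u v + travel I v w.
Hypothesis travel_ge0 : forall u v : node n, 0 <= travel I u v.
Hypothesis service_ge0 : forall u : node n, 0 <= service I u.

(* While i is on board, the current trip has contributed nothing yet if the
   walk has not left the origin of i, and otherwise at least the direct travel
   from there to the current node. *)
Lemma trip_ge i P x (a := service I (inl i) + travel I (inl i) (inr i)) :
  extension_path I d P x ->
  a *+ count_mem (inr i) P <= trip x i /\
  (i \in on_board x -> last (inl d) P = inl i \/
     a *+ count_mem (inr i) P +
       (service I (inl i) + travel I (inl i) (last (inl d) P)) <= trip x i).
Proof.
have: a = service I (inl i) + travel I (inl i) (inr i) by [].
clearbody a => aE.
elim=> [|{}P l j {}x Px [IH1 IH2] _ /and4P[_ jx _ _]].
  by split=> //; rewrite /= in_set1 => /eqP->; left.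
have sl := service_ge0 l; have := travel_ge0 l j.
have tri := travel_triangle (inl i) l j.
have := count_pickup i Px; have := picked_upE i Px.
rewrite last_rcons in IH2; rewrite last_rcons.
rewrite -[rcons (rcons P l) j]cats1 [count_mem _ (_ ++ _)]count_cat.
move: IH1 IH2; set c := count_mem (inr i) (rcons P l) => IH1 IH2 pickedE.
rewrite /= addn0; case: j jx tri => k kx tri cE tlj.
  rewrite [inl k == inr i]/= addn0 in_setU1 inl_eqE; case: (eqVneq k i) kx => [->|ki] kx /=.
    split; last by left.
    case: ifPn => [|_]; last by rewrite (negbTE kx).
    rewrite pickedE -has_pred1 has_count -leqNgt leqn0 cE addn_eq0.
    by move=> /andP[_ /eqP->].
  case: ifPn => ix; last by split.
  split; first by lra.
  by move=> _; right; case: (IH2 ix) => [el|]; [rewrite el in tlj *|]; lra.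
rewrite inr_eqE in_setD1 [i == k]eq_sym.
case: (eqVneq k i) kx tri tlj => [->|ki] kx tri tlj /=.
  rewrite kx addn1 mulrSr; split=> //.
  by case: (IH2 kx) => [el|]; [rewrite el in tlj *|]; lra.
rewrite addn0; case: ifPn => ix; last by split.
split; first by lra.
by move=> _; right; case: (IH2 ix) => [el|]; [rewrite el in tlj *|]; lra.
Qed.

Lemma count_dropoff_le1 i P x :
  ride_limit I i < 2 * travel I (inl i) (inr i) + service I (inl i) ->
  extension_path I d P x -> (count_mem (inr i) P <= 1)%N.
Proof.
move=> limit; elim=> [//|{}P l j {}x Px IH e f].
have [+ _] := trip_ge i (ExtendedPath Px e f).
case/and4P: f => _ jx _ /forall_inP lim.
rewrite -cats1 count_cat [count _ [:: j]]/= addn0.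
case: j e jx lim => k _ kx lim; first by rewrite [_ == _]/= addn0.
rewrite inr_eqE; case: (eqVneq k i) kx lim => [->|_] ix lim; last first.
  by rewrite addn0.
have := lim i ix; set a := _ + travel I _ _ => ub lb.
rewrite leqNgt; apply/negP => c_gt1.
have: a *+ 2 <= trip (extend_label I l (inr i) x) i.
  by apply: le_trans lb; rewrite ler_wpMn2l ?addr_ge0 // addn1.
by move: ub; rewrite /a; lra.
Qed.

End Walks.

Theorem proposition1 (R : realFieldType) (n : nat) (I : instance R n)
    (d : 'I_n)
    (edge_irr : irreflexive (edge I))
    (travel_ge0 : forall u v : node n, 0 <= travel I u v)
    (travel_triangle : forall u v w : node n,
       travel I u w <= travel I u v + travel I v w)
    (service_ge0 : forall u : node n, 0 <= service I u)
    (demand_ge0 : forall i : 'I_n, 0 <= demand I i)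
    (ride_limit_lt : forall i : 'I_n,
       ride_limit I i < 2 * travel I (inl i) (inr i) + service I (inl i))
    (P : seq (node n)) :
  generated I d P -> elementary P.
Proof.
move=> [_ [x Px x0]].
have dropoff i : (count_mem (inr i) P <= 1)%N.
  exact: (count_dropoff_le1 travel_triangle travel_ge0 service_ge0 _ Px).
have visits v : (count_mem v P <= 1)%N.
  by case: v => i; rewrite ?(count_pickup i Px) ?x0 ?in_set0; apply: dropoff.
apply: count_mem_uniq => v; rewrite -has_pred1 has_count.
by case: count (visits v) => [|[]].
Qed.
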